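(* (a) If $G_1$ and $G_2$ are $Q$-cospectral regular graphs, and $H$ is a regular graph, then $G_1\underline{\vee} H$ and $G_2\underline{\vee} H$ are $Q$-cospectral. (b) If $G$ is a regular graph, and $H_1$ and $H_2$ are $Q$-cospectral graphs with $\Gamma_{Q(H_1)}(x)=\Gamma_{Q(H_2)}(x)$, then $G\underline{\vee} H_1$ and $G\underline{\vee} H_2$ are $Q$-cospectral.
   Context: All graphs are finite, simple and undirected, with at least one vertex. $Q(G)=D(G)+A(G)$ is the signless Laplacian matrix of $G$ ($D(G)$ the diagonal degree matrix, $A(G)$ the adjacency matrix); two graphs are $Q$-cospectral if their signless Laplacian matrices have the same spectrum (eigenvalues counted with multiplicity). For an $n\times n$ matrix $M$, the $M$-coronal is the rational function $\Gamma_M(x)=\mathbf{1}_n^T(xI_n-M)^{-1}\mathbf{1}_n$, where $\mathbf{1}_n$ is the all-ones column vector. The subdivision graph $\mathcal{S}(G)$ is obtained from $G$ by inserting a new vertex into every edge of $G$; $I(G)$ denotes the set of inserted vertices. For vertex-disjoint graphs $G,H$, the subdivision-edge join $G\underline{\vee}H$ is the graph obtained from $\mathcal{S}(G)$ and $H$ by joining every vertex of $I(G)$ with every vertex of $V(H)$. *)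

(* Defs.v *)
From HB Require Import structures.
From mathcomp Require Import all_boot all_order all_algebra.

Set Implicit Arguments.
Unset Strict Implicit.
Unset Printing Implicit Defensive.

Import Order.TTheory GRing.Theory Num.Theory.
Local Open Scope ring_scope.

Record sgraph := SGraph {
  vertex :> finType;
  adj : rel vertex;
  adj_sym : symmetric adj;
  adj_irr : irreflexive adj;
  vertex_gt0 : (0 < #|vertex|)%N
}.

Definition degree (G : sgraph) (v : G) : nat := #|[set w | adj v w]|.

Definition regular (G : sgraph) : Prop :=
  exists r : nat, forall v : G, degree v = r.

Definition edges (G : sgraph) : {set {set G}} :=
  [set [set p.1; p.2] | p in [set p : G * G | adj p.1 p.2]].

Definition edge (G : sgraph) : finType := {e : {set G} | e \in edges G}.

Definition subdivision_adj (G : sgraph) : rel (G + edge G) :=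
  fun a b => match a, b with
  | inl v, inr e | inr e, inl v => v \in val e
  | _, _ => false
  end.

Lemma subdivision_adj_sym (G : sgraph) : symmetric (@subdivision_adj G).
Proof. by move=> [u|e] [v|f]. Qed.

Lemma subdivision_adj_irr (G : sgraph) : irreflexive (@subdivision_adj G).
Proof. by move=> [u|e]. Qed.

Lemma subdivision_gt0 (G : sgraph) : (0 < #|{: G + edge G}|)%N.
Proof. by rewrite card_sum addn_gt0 vertex_gt0. Qed.

Definition subdivision (G : sgraph) : sgraph :=
  SGraph (@subdivision_adj_sym G) (@subdivision_adj_irr G) (subdivision_gt0 G).

Definition inserted (G : sgraph) : {set subdivision G} :=
  [set (inr e : subdivision G) | e : edge G].

Definition sejoin_adj (G H : sgraph) : rel (subdivision G + H) :=
  fun a b => match a, b with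
  | inl u, inl v => adj u v
  | inr x, inr y => adj x y
  | inl u, inr _ | inr _, inl u => u \in inserted G
  end.

Lemma sejoin_adj_sym (G H : sgraph) : symmetric (@sejoin_adj G H).
Proof. by move=> [u|x] [v|y] //; apply: adj_sym. Qed.

Lemma sejoin_adj_irr (G H : sgraph) : irreflexive (@sejoin_adj G H).
Proof. by move=> [u|x]; apply: adj_irr. Qed.

Lemma sejoin_gt0 (G H : sgraph) : (0 < #|{: subdivision G + H}|)%N.
Proof. by rewrite card_sum addn_gt0 vertex_gt0. Qed.

Definition sejoin (G H : sgraph) : sgraph :=
  SGraph (@sejoin_adj_sym G H) (@sejoin_adj_irr G H) (sejoin_gt0 G H).

Definition adjacency_mx (R : nzRingType) (G : sgraph) : 'M[R]_#|G| :=
  \matrix_(i, j) (adj (enum_val i) (enum_val j))%:R.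

Definition degree_mx (R : nzRingType) (G : sgraph) : 'M[R]_#|G| :=
  diag_mx (\row_i (degree (enum_val i))%:R).

Definition signless_laplacian (R : nzRingType) (G : sgraph) : 'M[R]_#|G| :=
  degree_mx R G + adjacency_mx R G.

(* The multiset of eigenvalues, encoded by its multiplicity function: it maps
   a to the algebraic multiplicity of a (0 if a is not an eigenvalue). It is the
   full spectrum only over an algebraically closed field. *)
Definition spectrum (F : fieldType) (n : nat) (M : 'M[F]_n) : F -> nat :=
  fun a => mup a (char_poly M).

Definition Q_cospectral (C : numClosedFieldType) (G H : sgraph) : Prop :=
  spectrum (signless_laplacian C G) =1 spectrum (signless_laplacian C H).

(* The inverse is taken over the field of rational functions, where
   x I - M is always invertible. *)
Definition coronal (F : fieldType) (n : nat) (M : 'M[F]_n) :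
    {fraction {poly F}} :=
  let K := {fraction {poly F}} in
  let one : 'cV[K]_n := const_mx 1 in
  let xI_M : 'M[K]_n := (tofrac 'X)%:M - map_mx (fun a : F => tofrac a%:P) M in
  (one^T *m invmx xI_M *m one) 0 0.

(* Main.v *)
Require Import Defs.
From HB Require Import structures.
From mathcomp Require Import all_boot all_order all_algebra.
From mathcomp Require Import perm ring.

(** For [G] r-regular with [m] edges, incidence matrix [B] and [n] vertices, and
    [H] with [p] vertices, the signless Laplacian of the join is the block matrix
    [[r I, B, 0], [B^T, (2 + p) I, J], [0, J^T, Q(H) + m I]]. With [b = x - r] and
    [c = x - 2 - p], a Schur complement on the [H] block leaves a rank-one
    perturbation of the upper block, weighted by the coronal of [Q(H)] at
    [x - m]; regularity makes its effect explicit, and [B B^T = Q(G)] evaluates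
    the remaining determinant. So the characteristic polynomial of the join is
      [chi_{Q(H)}(x - m) c^(m - n) chi_{Q(G)}(b c)
         (1 - Gamma_{Q(H)}(x - m) m b / (b c - 2 r))],
    and [n], [m], [r] and [p] are determined by the spectra of [Q(G)] and [Q(H)].
    This is checked at the points where the denominators do not vanish, which is
    enough for an identity of polynomials over an infinite field. *)

Set Implicit Arguments.
Unset Strict Implicit.
Unset Printing Implicit Defensive.

Import Order.TTheory GRing.Theory Num.Theory.
Local Open Scope ring_scope.

(** * Determinants of block matrices and rank-one perturbations *)

Lemma det_block_schur (F : comUnitRingType) (m n : nat) (A : 'M[F]_m)
    (B : 'M_(m, n)) (C : 'M_(n, m)) (D : 'M_n) :
  D \in unitmx ->
  \det (block_mx A B C D) = \det D * \det (A - B *m invmx D *m C).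
Proof.
move=> uD; have -> : block_mx A B C D =
    block_mx (A - B *m invmx D *m C) B 0 D *m
    block_mx 1%:M 0 (invmx D *m C) 1%:M.
  rewrite mulmx_block !(mulmx0, mul0mx, mulmx1, add0r) mulmxA subrK.
  by rewrite mulmxA mulmxV // mul1mx.
by rewrite det_mulmx det_ublock det_lblock !det1 !mulr1 mulrC.
Qed.

(** Sylvester's identity: both sides are the determinant of [block_mx 1%:M U V 1%:M], with one or
    the other diagonal block eliminated. *)
Lemma det_1_sub_mulmx (F : comUnitRingType) (m n : nat) (U : 'M[F]_(m, n))
    (V : 'M_(n, m)) :
  \det (1%:M - U *m V) = \det (1%:M - V *m U).
Proof.
have -> : 1%:M - U *m V = 1%:M - U *m invmx 1%:M *m V by rewrite invmx1 mulmx1.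
rewrite -[LHS]mul1r -[X in X * _ = _](det1 F n) -det_block_schur ?unitmx1 //.
have -> : block_mx 1%:M U V 1%:M =
    block_mx 1%:M 0 V (1%:M - V *m U) *m block_mx 1%:M U 0 1%:M.
  by rewrite mulmx_block !(mulmx0, mul0mx, mulmx1, mul1mx, addr0) addrC subrK.
by rewrite det_mulmx det_ublock det_lblock !det1 !mul1r mulr1.
Qed.

(** The Schur complement is [A - g *: (u *m u^T)] for the scalar [g = w^T D^-1 w]. Substituting
    [u = A *m y] factors out [A], and Sylvester's identity turns the other factor into a 1 by 1
    determinant. *)
Lemma det_block_rank1 (F : fieldType) (m n : nat) (A : 'M[F]_m) (D : 'M_n)
    (u y : 'cV_m) (w : 'cV_n) :
  D \in unitmx -> A *m y = u ->
  \det (block_mx A (- (u *m w^T)) (- (w *m u^T)) D) =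
  \det D * (\det A *
    (1 - (w^T *m invmx D *m w) 0 0 * (u^T *m y) 0 0)).
Proof.
move=> uD Ay; rewrite det_block_schur // mulNmx mulNmx mulmxN opprK.
set g := (w^T *m invmx D *m w) 0 0.
have -> : u *m w^T *m invmx D *m (w *m u^T) = A *m (y *m (g *: u^T)).
  rewrite -!mulmxA (mulmxA w^T) (mulmxA _ w) [w^T *m _ *m w]mx11_scalar -/g.
  by rewrite mul_scalar_mx (mulmxA A) Ay.
rewrite -[X in X - _]mulmx1 -mulmxBr det_mulmx det_1_sub_mulmx det_mx11.
by rewrite -scalemxAl !mxE eqxx.
Qed.

(** * Choosing the order of the index set *)

(** The two enumerations differ by a permutation acting on rows and columns alike, so its sign
    enters twice and cancels. *)
Lemma det_enum_reindex (F : comPzRingType) (T : finType) (n : nat)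
    (f : 'I_n -> T) (q : T -> T -> F) :
  injective f -> n = #|T| ->
  \det (\matrix_(i < n, j < n) q (f i) (f j)) =
  \det (\matrix_(i < #|T|, j < #|T|) q (enum_val i) (enum_val j)).
Proof.
move=> f_inj n_eq; subst n.
have s_inj : injective (enum_rank \o f).
  by move=> i j /enum_rank_inj /f_inj.
pose s := perm s_inj.
have -> : (\matrix_(i, j) q (f i) (f j)) =
    row_perm s (col_perm s (\matrix_(i, j) q (enum_val i) (enum_val j))).
  by apply/matrixP=> i j; rewrite !mxE !permE /= !enum_rankK.
rewrite row_permE col_permE !det_mulmx !det_perm odd_permV mulrCA -signr_addb.
by rewrite addbb mulr1.
Qed.

(** Puts the left summand first, so that the matrix splits into blocks whatever order [enum_val]
    gives to the sum type. *)
Definition sum_index (T U : Type) (m n : nat) (f : 'I_m -> T) (g : 'I_n -> U)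
    (i : 'I_(m + n)) : T + U :=
  match split i with inl j => inl (f j) | inr k => inr (g k) end.

Lemma sum_index_lshift (T U : Type) (m n : nat) (f : 'I_m -> T) (g : 'I_n -> U)
    (i : 'I_m) :
  sum_index f g (lshift n i) = inl (f i).
Proof. by rewrite /sum_index (unsplitK (inl i)). Qed.

Lemma sum_index_rshift (T U : Type) (m n : nat) (f : 'I_m -> T) (g : 'I_n -> U)
    (i : 'I_n) :
  sum_index f g (rshift m i) = inr (g i).
Proof. by rewrite /sum_index (unsplitK (inr i)). Qed.

Lemma sum_index_inj (T U : Type) (m n : nat) (f : 'I_m -> T) (g : 'I_n -> U) :
  injective f -> injective g -> injective (sum_index f g).
Proof.
move=> f_inj g_inj i j; rewrite /sum_index.
case: (split_ordP i) => i' ->; case: (split_ordP j) => j' -> //.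
  by case=> /f_inj ->.
by case=> /g_inj ->.
Qed.

Lemma matrix_sum_index (F T U : Type) (m n : nat) (f : 'I_m -> T)
    (g : 'I_n -> U) (q : T + U -> T + U -> F) :
  \matrix_(i, j) q (sum_index f g i) (sum_index f g j) =
  block_mx (\matrix_(i, j) q (inl (f i)) (inl (f j)))
           (\matrix_(i, j) q (inl (f i)) (inr (g j)))
           (\matrix_(i, j) q (inr (g i)) (inl (f j)))
           (\matrix_(i, j) q (inr (g i)) (inr (g j))).
Proof.
apply/matrixP=> i j; rewrite mxE /sum_index.
case: (split_ordP i) => i' ->; case: (split_ordP j) => j' ->.
- by rewrite block_mxEul mxE.
- by rewrite block_mxEur mxE.
- by rewrite block_mxEdl mxE.
- by rewrite block_mxEdr mxE.
Qed.

(** * Characteristic polynomials and coronals, evaluated at a point *)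

Lemma horner_char_poly_mx (F : comNzRingType) (n : nat) (A : 'M[F]_n) (a : F) :
  map_mx (horner_eval a) (char_poly_mx A) = a%:M - A.
Proof.
by apply/matrixP=> i j; rewrite !mxE /= horner_evalE !hornerE hornerMn hornerX.
Qed.

Lemma horner_char_poly (F : comNzRingType) (n : nat) (A : 'M[F]_n) (a : F) :
  (char_poly A).[a] = \det (a%:M - A).
Proof. by rewrite -horner_evalE -det_map_mx horner_char_poly_mx. Qed.

Lemma const1_mulmx_const1 (F : pzRingType) (n : nat) (A : 'M[F]_n) :
  ((const_mx 1)^T *m A *m const_mx 1 : 'M_1) 0 0 = \sum_i \sum_j A i j.
Proof.
rewrite exchange_big mxE; apply: eq_bigr => j _; rewrite !mxE mulr1.
by apply: eq_bigr => i _; rewrite !mxE mul1r.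
Qed.

(** By Cramer's rule, the numerator of the coronal over the denominator [char_poly A]; the fraction
    need not be reduced. *)
Definition coronal_num (F : comNzRingType) (n : nat) (A : 'M[F]_n) : {poly F} :=
  \sum_i \sum_j (\adj (char_poly_mx A)) i j.

Lemma coronalE (F : fieldType) (n : nat) (A : 'M[F]_n) :
  coronal A = tofrac (coronal_num A) / tofrac (char_poly A).
Proof.
rewrite /coronal const1_mulmx_const1; set M := (X in invmx X).
have -> : M = map_mx (@tofrac {poly F}) (char_poly_mx A).
  by apply/matrixP=> i j; rewrite !mxE rmorphB rmorphMn.
have nz : char_poly A != 0 by rewrite monic_neq0 ?char_poly_monic.
rewrite /invmx unitmxE det_map_mx unitfE tofrac_eq0 -/(char_poly A) nz.
rewrite /coronal_num [in RHS]rmorph_sum [in RHS]mulr_suml; apply: eq_bigr => i _.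
rewrite [in RHS]rmorph_sum [in RHS]mulr_suml; apply: eq_bigr => j _.
by rewrite -map_mx_adj !mxE mulrC.
Qed.

Lemma horner_coronal_num (F : fieldType) (n : nat) (A : 'M[F]_n) (a : F) :
  (char_poly A).[a] != 0 ->
  ((const_mx 1)^T *m invmx (a%:M - A) *m const_mx 1 : 'M_1) 0 0 =
  (coronal_num A).[a] / (char_poly A).[a].
Proof.
move=> nz; rewrite const1_mulmx_const1 /invmx unitmxE unitfE.
rewrite -horner_char_poly nz -(horner_char_poly_mx A a).
move: (char_poly A).[a] => c.
rewrite /coronal_num horner_sum mulr_suml; apply: eq_bigr => i _.
rewrite horner_sum mulr_suml; apply: eq_bigr => j _.
by rewrite -map_mx_adj !mxE mulrC.
Qed.

(** * Polynomials determined by their values or by their roots *)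

(** The product [s * (p - q)] vanishes at every point of an infinite field, hence is zero, and [s]
    cancels. *)
Lemma poly_eq_cofinite (F : numFieldType) (p q s : {poly F}) :
  s != 0 -> (forall a, s.[a] != 0 -> p.[a] = q.[a]) -> p = q.
Proof.
move=> s0 pq; apply/eqP; rewrite -subr_eq0 -[_ == 0]/(false || _).
rewrite -(negbTE s0) -mulf_eq0; set t := s * _.
apply: contraT => t0.
have t_root a : root t a.
  rewrite /root /t hornerM hornerD hornerN; have [->|/pq ->] := eqVneq s.[a] 0.
    by rewrite mul0r.
  by rewrite subrr mulr0.
(* In characteristic 0 these are [size t] distinct roots, one more than the degree of [t]. *)
pose rs := [seq i%:R : F | i <- iota 0 (size t)].
have all_rs : all (root t) rs by apply/allP.
have uniq_rs : uniq rs.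
  by rewrite map_inj_uniq ?iota_uniq // => i j /eqP; rewrite eqr_nat => /eqP.
by have := max_poly_roots t0 all_rs uniq_rs; rewrite size_map size_iota ltnn.
Qed.

(** Over an algebraically closed field a monic polynomial is the product of its linear factors, so
    root multiplicities determine it. *)
Lemma char_poly_cospectral (C : numClosedFieldType) (m n : nat)
    (A : 'M[C]_m) (B : 'M[C]_n) :
  spectrum A =1 spectrum B -> char_poly A = char_poly B.
Proof.
have [rs rsE] := closed_field_poly_normal (char_poly A).
have [ts tsE] := closed_field_poly_normal (char_poly B).
move: rsE tsE; rewrite !(monicP (char_poly_monic _)) !scale1r => rsE tsE spAB.
rewrite rsE tsE; apply: perm_big; apply/allP=> x _ /=; apply/eqP.
by have := spAB x; rewrite /spectrum rsE tsE !mu_prod_XsubC.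
Qed.

(** * Edges and incidences *)

Lemma mem_edges (G : sgraph) (u v : G) : ([set u; v] \in edges G) = adj u v.
Proof.
apply/imsetP/idP => [[[x y]]|uv]; last by exists (u, v); rewrite ?inE.
rewrite inE /= => xy uvE.
have x_neq_y : x != y by apply: contraTneq xy => ->; rewrite adj_irr.
(* An edge has two elements, so [[set u; v]] cannot collapse to a singleton. *)
have u_neq_v : u != v.
  apply: contra_eqN (congr1 (fun A : {set G} => #|A|) uvE) => /eqP ->.
  by rewrite !cards2 eqxx x_neq_y.
have : u \in [set x; y] by rewrite -uvE set21.
have : v \in [set x; y] by rewrite -uvE set22.
move: u_neq_v; rewrite !inE.
move=> uv /orP[]/eqP vE /orP[]/eqP uE; move: uv; rewrite uE vE ?eqxx //.
by rewrite adj_sym.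
Qed.

Lemma card_edge (G : sgraph) (e : edge G) : #|val e| = 2%N.
Proof.
have /imsetP[[x y]] := valP e; rewrite inE /= => xy ->.
by rewrite cards2; case: eqVneq xy => // ->; rewrite adj_irr.
Qed.

Lemma card_edge_pred (G : sgraph) (P : pred {set G}) :
  #|[set e : edge G | P (val e)]| = #|[set e in edges G | P e]|.
Proof.
rewrite -(card_imset _ val_inj); apply: eq_card => e.
apply/imsetP/idP => [[f]|]; rewrite !inE; first by move=> ? ->; rewrite (valP f).
by case/andP=> eG Pe; exists (Sub e eG); rewrite ?inE SubK.
Qed.

Lemma edge_mem2 (G : sgraph) (e : {set G}) (u v : G) :
  e \in edges G -> u != v -> u \in e -> v \in e -> e = [set u; v].
Proof.
move=> eG uv ue ve; apply/esym/eqP; rewrite eqEcard subUset !sub1set ue ve /=.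
by rewrite cards2 uv (card_edge (Sub e eG : edge G)).
Qed.

(** Sending a neighbour [w] to [[set v; w]] is a bijection onto the edges at [v]. *)
Lemma card_edge_mem (G : sgraph) (v : G) :
  #|[set e : edge G | v \in val e]| = degree v.
Proof.
rewrite (card_edge_pred (fun e : {set G} => v \in e)) /degree.
rewrite -[RHS](card_in_imset (f := fun w => [set v; w])); last first.
  move=> w w'; rewrite !inE => vw vw' /setP/(_ w); rewrite !inE eqxx orbT.
  by case: eqVneq vw => [->|_ _ /esym/eqP //]; rewrite adj_irr.
apply: eq_card => e; rewrite inE.
apply/idP/imsetP => [/andP[eG ve]|[w]]; last first.
  by rewrite inE => vw ->; rewrite mem_edges vw set21.
have /cards2P[x [y [xy exy]]] : #|e| == 2%N.
  by rewrite (card_edge (Sub e eG : edge G)).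
move: ve eG; rewrite exy !inE => /orP[]/eqP ->; last rewrite setUC.
  by rewrite mem_edges => vy; exists y; rewrite ?inE.
by rewrite mem_edges => vx; exists x; rewrite ?inE.
Qed.

Lemma card_edge_mem2 (G : sgraph) (u v : G) : u != v ->
  #|[set e : edge G | (u \in val e) && (v \in val e)]| = adj u v.
Proof.
move=> uv; rewrite (card_edge_pred (fun e : {set G} => (u \in e) && (v \in e))).
rewrite -mem_edges; case: (boolP (_ \in _)) => [uvG|uvG].
  rewrite -[RHS](cards1 [set u; v]); apply: eq_card => e; rewrite !inE.
  apply/idP/eqP => [/and3P[eG ue ve]|->]; first exact: edge_mem2.
  by rewrite uvG set21 set22.
apply/eqP; rewrite cards_eq0; apply/set0Pn => -[e]; rewrite inE.
by case/and3P=> eG ue ve; case/negP: uvG; rewrite -(edge_mem2 eG uv ue ve).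
Qed.

Definition incidence_mx (R : nzRingType) (G : sgraph) :
    'M[R]_(#|G|, #|edge G|) :=
  \matrix_(i < #|G|, j < #|edge G|) (enum_val i \in val (enum_val j))%:R.

Lemma sum_incidence_edge (G : sgraph) (v : G) :
  (\sum_(e : edge G) (v \in val e) = degree v)%N.
Proof.
rewrite -card_edge_mem -sum1_card [RHS]big_mkcond; apply: eq_bigr => e _.
by rewrite inE; case: ifP.
Qed.

Lemma sum_incidence_vertex (G : sgraph) (e : edge G) :
  (\sum_(v : G) (v \in val e) = 2)%N.
Proof.
rewrite -(card_edge e) -sum1_card [RHS]big_mkcond; apply: eq_bigr => v _.
by case: ifP.
Qed.

(** Handshake lemma, by double counting of incidences. *)
Lemma sum_degree (G : sgraph) : (\sum_(v : G) degree v = #|edge G| * 2)%N.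
Proof.
under eq_bigr do rewrite -sum_incidence_edge.
rewrite exchange_big /=; under eq_bigr do rewrite sum_incidence_vertex.
by rewrite sum_nat_const.
Qed.

Lemma degreeE (G : sgraph) (v : G) : (degree v = \sum_w adj v w)%N.
Proof.
rewrite /degree -sum1_card [LHS]big_mkcond; apply: eq_bigr => w _.
by rewrite inE; case: ifP.
Qed.

(** * Degrees in the join *)

Lemma inl_notin_inserted (G : sgraph) (v : G) :
  ((inl v : subdivision G) \in inserted G) = false.
Proof. by apply/imsetP => -[]. Qed.

Lemma inr_in_inserted (G : sgraph) (e : edge G) :
  (inr e : subdivision G) \in inserted G.
Proof. exact: imset_f. Qed.

Lemma degree_sejoin_vertex (G H : sgraph) (v : G) :
  degree (inl (inl v) : sejoin G H) = degree v.
Proof.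
rewrite degreeE big_sumType /= [X in (X + _)%N]big_sumType /=.
rewrite sum_incidence_edge big1 ?add0n // big1 ?addn0 // => w _.
by rewrite inl_notin_inserted.
Qed.

Lemma degree_sejoin_edge (G H : sgraph) (e : edge G) :
  degree (inl (inr e) : sejoin G H) = (2 + #|H|)%N.
Proof.
rewrite degreeE big_sumType /= [X in (X + _)%N]big_sumType /=.
rewrite sum_incidence_vertex big1 ?addn0 //; congr addn.
by rewrite -sum1_card; apply: eq_bigr => w _; rewrite inr_in_inserted.
Qed.

Lemma degree_sejoin_join (G H : sgraph) (x : H) :
  degree (inr x : sejoin G H) = (#|edge G| + degree x)%N.
Proof.
rewrite degreeE big_sumType /= [X in (X + _)%N]big_sumType /= -degreeE.
congr addn; rewrite big1 ?add0n => [|v _]; last by rewrite inl_notin_inserted.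
by rewrite -sum1_card; apply: eq_bigr => e _; rewrite inr_in_inserted.
Qed.

(** * The signless Laplacian of the join as a block matrix *)

(** An entry of the product counts the edges containing both vertices: the degree on the diagonal,
    the adjacency elsewhere. *)
Lemma mul_incidence_tr (R : nzRingType) (G : sgraph) :
  incidence_mx R G *m (incidence_mx R G)^T = signless_laplacian R G.
Proof.
apply/matrixP=> i j; rewrite !mxE.
pose u := enum_val i; pose v := enum_val j.
transitivity (\sum_(e : edge G) ((u \in val e) && (v \in val e))%:R : R).
  rewrite (big_enum_val (A := edge G)); apply: eq_bigr => k _.
  by rewrite !mxE -natrM mulnb.
transitivity (#|[set e : edge G | (u \in val e) && (v \in val e)]|%:R : R).
  rewrite -sum1_card natr_sum [RHS]big_mkcond; apply: eq_bigr => e _.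
  by rewrite inE; case: ifP.
rewrite -/u -/v; have [ij|ij] := eqVneq i j.
  rewrite -[v]/(enum_val j) -ij -/u adj_irr addr0 mulr1n -card_edge_mem.
  by under eq_finset do rewrite andbb.
by rewrite card_edge_mem2 ?add0r // (inj_eq enum_val_inj).
Qed.

(* Entry of [a I - Q(G)], indexed by the vertices themselves instead of their
   ranks. *)
Definition char_entry (F : nzRingType) (G : sgraph) (a : F) (x y : G) : F :=
  a *+ (x == y) - ((degree x)%:R *+ (x == y) + (adj x y)%:R).

Lemma sub_signless_laplacian (F : nzRingType) (G : sgraph) (a : F) :
  a%:M - signless_laplacian F G =
  \matrix_(i, j) char_entry a (enum_val i) (enum_val j).
Proof.
by apply/matrixP=> i j; rewrite !mxE /char_entry (inj_eq enum_val_inj).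
Qed.

(** The order is: vertices of [G], inserted vertices, vertices of [H]. The vector [u] is the
    indicator of the inserted vertices, which makes the joining block a rank-one product. *)
Lemma sub_signless_laplacian_sejoin (F : comNzRingType) (G H : sgraph)
    (r : nat) (a : F) :
  (forall v : G, degree v = r) ->
  let u : 'cV[F]_(#|G| + #|edge G|) := col_mx 0 (const_mx 1) in
  let w : 'cV[F]_#|H| := const_mx 1 in
  (char_poly (signless_laplacian F (sejoin G H))).[a] =
  \det (block_mx
    (block_mx (a - r%:R)%:M (- incidence_mx F G)
       (- (incidence_mx F G)^T) (a - (2 + #|H|)%:R)%:M)
    (- (u *m w^T)) (- (w *m u^T))
    ((a - #|edge G|%:R)%:M - signless_laplacian F H)).
Proof.
move=> reg u w; rewrite horner_char_poly sub_signless_laplacian.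
pose f : 'I_(#|G| + #|edge G| + #|H|) -> sejoin G H :=
  sum_index (sum_index enum_val enum_val) enum_val.
rewrite -(@det_enum_reindex _ _ _ f); last 2 first.
- exact: sum_index_inj (sum_index_inj enum_val_inj enum_val_inj) enum_val_inj.
- by rewrite !card_sum.
rewrite (matrix_sum_index _ _ (@char_entry F (sejoin G H) a)).
rewrite (matrix_sum_index _ _ (fun x y : subdivision G =>
  char_entry a (inl x : sejoin G H) (inl y : sejoin G H))).
congr (\det (block_mx (block_mx _ _ _ _) _ _ _)); apply/matrixP=> i j.
- rewrite !mxE /char_entry /= degree_sejoin_vertex reg addr0 -mulrnBl.
  by rewrite (inj_eq (inj_comp inl_inj inl_inj)) (inj_eq enum_val_inj).
- by rewrite !mxE /char_entry /= !mulr0n !add0r.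
- by rewrite !mxE /char_entry /= !mulr0n !add0r.
- rewrite !mxE /char_entry /= degree_sejoin_edge addr0 -mulrnBl.
  by rewrite (inj_eq (inj_comp inl_inj inr_inj)) (inj_eq enum_val_inj).
- rewrite mxE [RHS]mxE [(_ *m _) _ _]mxE big_ord1 [_^T _ _]mxE /u /w.
  rewrite /char_entry /= !mulr0n !add0r; congr (- _).
  case: (split_ordP i) => k ->.
    rewrite sum_index_lshift inl_notin_inserted col_mxEu !mxE.
    by rewrite ?mul0r ?mulr0.
  rewrite sum_index_rshift inr_in_inserted col_mxEd !mxE.
  by rewrite mulr1.
- rewrite mxE [RHS]mxE [(_ *m _) _ _]mxE big_ord1 [_^T _ _]mxE /u /w.
  rewrite /char_entry /= !mulr0n !add0r; congr (- _).
  case: (split_ordP j) => k ->.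
    rewrite sum_index_lshift inl_notin_inserted col_mxEu !mxE.
    by rewrite ?mul0r ?mulr0.
  rewrite sum_index_rshift inr_in_inserted col_mxEd !mxE.
  by rewrite mulr1.
- rewrite !mxE /char_entry /= degree_sejoin_join (inj_eq inr_inj).
  by rewrite (inj_eq enum_val_inj) natrD mulrnDl mulrnBl !opprD !addrA.
Qed.

(** * The characteristic polynomial of the join *)

Lemma horner_char_poly_sejoin (F : fieldType) (G H : sgraph) (r : nat) (a : F)
    (m : F := #|edge G|%:R) (b : F := a - r%:R) (c : F := a - (2 + #|H|)%:R)
    (QG := signless_laplacian F G) (QH := signless_laplacian F H) :
  (forall v : G, degree v = r) ->
  c != 0 -> b * c - 2 * r%:R != 0 -> (char_poly QH).[a - m] != 0 ->
  (char_poly (signless_laplacian F (sejoin G H))).[a] =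
  (char_poly QH).[a - m] *
  (c ^+ #|edge G| * (c ^- #|G| * (char_poly QG).[b * c]) *
   (1 - (coronal_num QH).[a - m] / (char_poly QH).[a - m] *
        (m * (b / (b * c - 2 * r%:R))))).
Proof.
move=> reg c0 d0 chi0; rewrite (sub_signless_laplacian_sejoin _ _ reg).
rewrite -/m -/b -/c -/QH; set A := block_mx b%:M _ _ _.
set d := b * c - 2 * r%:R in d0 *; have dE : d = b * c - 2 * r%:R by [].
clearbody d.
(* Solve [A *m y = u] with [y] constant on each block: a vertex meets [r] edges and an edge has 2
   ends, so the values [s], [t] satisfy [b s - r t = 0] and [c t - 2 s = 1], a system of determinant
   [d]. *)
pose y : 'cV[F]_(#|G| + #|edge G|) :=
  col_mx (const_mx (r%:R / d)) (const_mx (b / d)).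
have Ay : A *m y = col_mx 0 (const_mx 1).
  rewrite mul_block_col; congr col_mx; apply/colP=> i.
    rewrite mul_scalar_mx mulNmx !mxE.
    under eq_bigr do rewrite !mxE.
    rewrite -mulr_suml -natr_sum.
    rewrite -(big_enum_val (A := edge G)
      (fun e : edge G => nat_of_bool (enum_val i \in val e))).
    rewrite sum_incidence_edge reg; ring.
  rewrite mul_scalar_mx mulNmx !mxE.
  under eq_bigr do rewrite !mxE.
  rewrite -mulr_suml -natr_sum.
  rewrite -(big_enum_val (A := G)
    (fun v : G => nat_of_bool (v \in val (enum_val i)))).
  rewrite sum_incidence_vertex.
  transitivity ((b * c - 2 * r%:R) / d); first by ring.
  by rewrite -dE mulfV.
rewrite (det_block_rank1 _ _ Ay) ?unitmxE ?unitfE -?horner_char_poly //.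
rewrite horner_coronal_num //.
(* Eliminating the block [c%:M] leaves [b I - c^-1 Q(G) = c^-1 (b c I - Q(G))]. *)
have -> : \det A = c ^+ #|edge G| * (c ^- #|G| * (char_poly QG).[b * c]).
  have uc : c%:M \in @unitmx F #|edge G|.
    by rewrite unitmxE det_scalar unitfE expf_neq0.
  rewrite det_block_schur // det_scalar horner_char_poly -exprVn -detZ.
  congr (_ * \det _).
  rewrite invmx_scalar mulNmx mulmxN mulNmx opprK mul_mx_scalar -scalemxAl.
  by rewrite mul_incidence_tr scalerBr scale_scalar_mx mulrC mulfK.
congr (_ * (_ * (1 - _ * _))).
(* The product [u^T *m y] adds the value [b / d] over the inserted vertices. *)
rewrite tr_col_mx mul_row_col !mxE big1 ?add0r => [|i _]; last first.
  by rewrite !mxE mul0r.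
under eq_bigr do rewrite !mxE mul1r.
by rewrite sumr_const card_ord -mulr_natl.
Qed.

(** * Graph parameters read off the spectrum, and the comparison of joins *)

Lemma char_poly_size_eq (F : nzRingType) (m n : nat) (A : 'M[F]_m)
    (B : 'M[F]_n) :
  char_poly A = char_poly B -> m = n.
Proof.
by move/(congr1 (fun p : {poly F} => size p)); rewrite !size_char_poly => -[].
Qed.

Lemma trace_signless_laplacian (R : nzRingType) (G : sgraph) :
  \tr (signless_laplacian R G) = (\sum_(v : G) degree v)%:R.
Proof.
rewrite natr_sum (big_enum_val (A := G)); apply: eq_bigr => i _.
by rewrite !mxE eqxx mulr1n adj_irr addr0.
Qed.

(** The degree of the polynomial gives the order [n], and its subleading coefficient gives the
    trace, which is both twice the number of edges and [n r], with [n] positive. *)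
Lemma char_poly_regular (F : numFieldType) (G1 G2 : sgraph) (r1 r2 : nat) :
  (forall v : G1, degree v = r1) -> (forall v : G2, degree v = r2) ->
  char_poly (signless_laplacian F G1) = char_poly (signless_laplacian F G2) ->
  [/\ #|G1| = #|G2|, #|edge G1| = #|edge G2| & r1 = r2].
Proof.
move=> reg1 reg2 chiE; have nE := char_poly_size_eq chiE.
have degE : (\sum_(v : G1) degree v = \sum_(v : G2) degree v)%N.
  apply/eqP; rewrite -(eqr_nat F) -!trace_signless_laplacian -eqr_opp.
  by rewrite -!char_poly_trace ?vertex_gt0 // chiE nE.
split=> //.
  by apply/eqP; rewrite -(eqn_pmul2r (isT : (0 < 2)%N)) -!sum_degree degE.
move: degE; under eq_bigr do rewrite reg1; under [RHS]eq_bigr do rewrite reg2.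
rewrite !sum_nat_const !cardT -!cardE nE => /eqP.
by rewrite eqn_pmul2l ?vertex_gt0 // => /eqP.
Qed.

(** Covers both claims: one fixes the second factor of the join, the other the first. *)
Lemma char_poly_sejoin_eq (F : numFieldType) (G1 G2 H1 H2 : sgraph)
    (r1 r2 : nat) :
  (forall v : G1, degree v = r1) -> (forall v : G2, degree v = r2) ->
  char_poly (signless_laplacian F G1) = char_poly (signless_laplacian F G2) ->
  char_poly (signless_laplacian F H1) = char_poly (signless_laplacian F H2) ->
  coronal (signless_laplacian F H1) = coronal (signless_laplacian F H2) ->
  char_poly (signless_laplacian F (sejoin G1 H1)) =
  char_poly (signless_laplacian F (sejoin G2 H2)).
Proof.
move=> reg1 reg2 chiG chiH corH.
have [nE mE rE] := char_poly_regular reg1 reg2 chiG; subst r2.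
have pE := char_poly_size_eq chiH.
have numE : coronal_num (signless_laplacian F H1) =
            coronal_num (signless_laplacian F H2).
  apply/eqP; rewrite -tofrac_eq; apply/eqP.
  move: corH; rewrite !coronalE -chiH => /mulIf-> //.
  by rewrite invr_eq0 tofrac_eq0 monic_neq0 ?char_poly_monic.
(* The values of [s1], [s2], [s3] at [a] are the three quantities that [horner_char_poly_sejoin]
   requires to be nonzero. *)
pose s1 : {poly F} := 'X - (2 + #|H1|)%:R%:P.
pose s2 : {poly F} := ('X - r1%:R%:P) * s1 - (2 * r1%:R)%:P.
pose s3 := char_poly (signless_laplacian F H1) \Po ('X - #|edge G1|%:R%:P).
apply: (@poly_eq_cofinite _ _ _ (s1 * s2 * s3)) => [|a].
  rewrite !mulf_neq0 //.
  - by rewrite polyXsubC_eq0.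
  (* [s2] is a product of two linear factors minus a constant, so its quadratic term survives. *)
  - rewrite -size_poly_gt0 size_polyDl.
      by rewrite size_mul ?polyXsubC_eq0 // !size_XsubC.
    rewrite size_mul ?polyXsubC_eq0 // !size_XsubC size_polyN.
    exact: leq_ltn_trans (size_polyC_leq1 _) _.
  - by rewrite comp_poly_eq0 ?size_XsubC // monic_neq0 ?char_poly_monic.
rewrite !hornerM !mulf_eq0 !negb_or horner_comp !hornerE -andbA.
case/and3P=> c0 d0 chi0.
rewrite (horner_char_poly_sejoin reg1) // (horner_char_poly_sejoin reg2);
  by rewrite -?chiH -?chiG -?numE -?mE -?nE -?pE.
Qed.

Theorem corollary3p11 (C : numClosedFieldType) :
  (forall G1 G2 H : sgraph,
     regular G1 -> regular G2 -> Q_cospectral C G1 G2 -> regular H ->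
     Q_cospectral C (sejoin G1 H) (sejoin G2 H)) /\
  (forall G H1 H2 : sgraph,
     regular G -> Q_cospectral C H1 H2 ->
     coronal (signless_laplacian C H1) = coronal (signless_laplacian C H2) ->
     Q_cospectral C (sejoin G H1) (sejoin G H2)).
Proof.
split=> [G1 G2 H [r1 reg1] [r2 reg2] /char_poly_cospectral chiG _ a|].
  by rewrite /spectrum (char_poly_sejoin_eq (H2 := H) reg1 reg2 chiG).
move=> G H1 H2 [r reg] /char_poly_cospectral chiH corH a.
by rewrite /spectrum (char_poly_sejoin_eq reg reg erefl chiH corH).
Qed.
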